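(* Let $D_n^{\ast}$ ($n\in\mathbb{N}$) be the Dunkl–Appell–Szász–Durrmeyer operators defined in the context, and let $$E:=\left\{f:[0,\infty)\to\mathbb{R}\;:\;\frac{f(x)}{1+x^{2}}\text{ is convergent (to a finite limit) as }x\to\infty\right\}.$$ Then for any $f\in C[0,\infty)\cap E$, $$\lim_{n\to\infty}D_n^{\ast}(f;x)=f(x),$$ uniformly on each compact subset of $[0,\infty)$.
   Context: Fix real numbers $\mu\ge 0$ and $\lambda\ge 0$. For $k\in\mathbb{N}_0$ put $\theta_k=0$ if $k$ is even and $\theta_k=1$ if $k$ is odd. The coefficients $\gamma_\mu$ are $$\gamma_\mu(2k)=\frac{2^{2k}k!\,\Gamma(k+\mu+\frac12)}{\Gamma(\mu+\frac12)},\qquad \gamma_\mu(2k+1)=\frac{2^{2k+1}k!\,\Gamma(k+\mu+\frac32)}{\Gamma(\mu+\frac12)},\quad k\in\mathbb{N}_0,$$ and they satisfy $\gamma_\mu(k+1)=(k+1+2\mu\theta_{k+1})\gamma_\mu(k)$. The Dunkl exponential is $e_\mu(x)=\sum_{k=0}^\infty \frac{x^k}{\gamma_\mu(k)}$. Let $(a_r)_{r\ge0}$ be real numbers with $a_0\neq0$ such that $A(t)=\sum_{r=0}^\infty\frac{a_r}{\gamma_\mu(r)}t^r$ is analytic in a disc $|t|<R$ with $R>1$; assume $A(1)\ne0$ and $\frac{a_r}{A(1)}\ge0$ for all $r\ge0$. The Dunkl–Appell polynomials $p_k$ are $$p_k(x)=\sum_{m=0}^k\frac{\gamma_\mu(k)}{\gamma_\mu(m)\gamma_\mu(k-m)}a_{k-m}x^m,$$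 equivalently $A(t)e_\mu(xt)=\sum_{k=0}^\infty\frac{p_k(x)}{\gamma_\mu(k)}t^k$. For $n\in\mathbb{N}=\{1,2,\dots\}$, $x\in[0,\infty)$ and $f\in C[0,\infty)$ (for which the expression is defined), $$D_n^{\ast}(f;x)=\frac{1}{e_\mu(nx)A(1)}\sum_{k=0}^\infty\frac{p_k(nx)}{\gamma_\mu(k)}\frac{n^{k+2\mu\theta_k+\lambda+1}}{\Gamma(k+2\mu\theta_k+\lambda+1)}\int_0^\infty e^{-nt}t^{k+2\mu\theta_k+\lambda}f(t)\,dt.$$ $C[0,\infty)$ denotes the continuous real-valued functions on $[0,\infty)$. *)

(* Defs.v *)
From mathcomp Require Import all_boot all_order all_algebra.
From mathcomp Require Import all_classical all_reals all_analysis.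

Set Implicit Arguments.
Unset Strict Implicit.
Unset Printing Implicit Defensive.

Import Order.TTheory GRing.Theory Num.Theory.
Import numFieldNormedType.Exports.

Local Open Scope classical_set_scope.
Local Open Scope ring_scope.

(* Euler's integral; it represents the Gamma function for s > 0, and every
   argument occurring below is positive as soon as mu, lam >= 0. *)
Definition Gamma {R : realType} (s : R) : R :=
  \int[lebesgue_measure]_(t in `]0, +oo[) (t `^ (s - 1) * expR (- t)).

Definition theta {R : realType} (k : nat) : R := (odd k)%:R.

Definition gamma_dunkl {R : realType} (mu : R) (k : nat) : R :=
  let j := k./2 in
  if odd k
  then 2 ^+ (2 * j + 1) * j`!%:R * Gamma (j%:R + mu + 3 / 2) / Gamma (mu + 1 / 2)
  else 2 ^+ (2 * j) * j`!%:R * Gamma (j%:R + mu + 1 / 2) / Gamma (mu + 1 / 2).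

Definition exp_dunkl {R : realType} (mu x : R) : R :=
  limn (pseries (fun k => (gamma_dunkl mu k)^-1) x).

Definition appell_coef {R : realType} (mu : R) (a : nat -> R) (r : nat) : R :=
  a r / gamma_dunkl mu r.

Definition appell_gen {R : realType} (mu : R) (a : nat -> R) (t : R) : R :=
  limn (pseries (appell_coef mu a) t).

(* The power series with coefficients c converges at every point of the disc
   of radius rho centered at 0, so that its sum is analytic there. *)
Definition analytic_disc {R : realType} (c : nat -> R) (rho : R) : Prop :=
  forall t : R, `|t| < rho -> cvgn (pseries c t).

Definition appell_poly {R : realType} (mu : R) (a : nat -> R) (k : nat) (x : R)
    : R :=
  \sum_(m < k.+1) gamma_dunkl mu k / (gamma_dunkl mu m * gamma_dunkl mu (k - m))
                  * a (k - m)%N * x ^+ m.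

(* Only the values of f on [0, +oo[ matter. The operator is total: where the
   integral or the series diverges, its value is meaningless. *)
Definition Dstar {R : realType} (mu lam : R) (a : nat -> R) (n : nat)
    (f : R -> R) (x : R) : R :=
  1 / (exp_dunkl mu (n%:R * x) * appell_gen mu a 1) *
  limn [series
    appell_poly mu a k (n%:R * x) / gamma_dunkl mu k *
    (n%:R `^ (k%:R + 2 * mu * theta k + lam + 1) /
       Gamma (k%:R + 2 * mu * theta k + lam + 1)) *
    \int[lebesgue_measure]_(t in `[0, +oo[)
       (expR (- (n%:R * t)) * t `^ (k%:R + 2 * mu * theta k + lam) * f t)]_k.

Definition in_E {R : realType} (f : R -> R) : Prop :=
  exists l : R, f x / (1 + x ^+ 2) @[x --> +oo] --> l.

(* Main.v *)
Require Import Defs.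
From mathcomp Require Import all_boot all_order all_algebra.
From mathcomp Require Import all_classical all_reals all_analysis.
From mathcomp Require Import measurable_realfun.
From mathcomp Require Import ring lra.

Import Order.TTheory GRing.Theory Num.Theory.
Import numFieldNormedType.Exports.

Local Open Scope classical_set_scope.
Local Open Scope ring_scope.

(** Put [u = n x].  The operator averages [f] against a probability law, so the
    theorem is an instance of Korovkin's argument, with Chebyshev's inequality
    replaced by a pointwise quadratic majorant.

    The law is a mixture of gamma laws.  The mixing weights are
    [w_k = sum_(m + r = k) P_m b_r], the Cauchy product of the two probability
    sequences [P_m = u^m / (gamma_mu(m) e_mu(u))] and
    [b_r = a_r / (gamma_mu(r) A(1))], the latter nonnegative by the positivity
    assumption on the [a_r].  The k-th gamma law has rate [n] and shape
    [s_k = k + 2 mu theta_k + lambda + 1], hence mean [s_k / n] and variance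
    [s_k / n^2].

    Three estimates suffice.
    - [quadratic_modulus]: since [f] is continuous and grows at most
      quadratically, for every [e > 0] there is [C] such that
      [|f t - f x| <= e + C (t - x)^2] for all [x] in [K] and [t >= 0].
    - [gamma_mean_close]: integrated against the k-th gamma law, this bound
      becomes [e + C V_k], with [V_k = s_k / n^2 + (s_k / n - x)^2].  It follows
      from the functional equation of Gamma, proved by parts.
    - The sum of the [w_k V_k] is [O(1/n)] uniformly for [x] in [K].  Write
      [h_m = m + 2 mu theta_m], so that
      [gamma_mu(m) = h_m gamma_mu(m - 1)] and [P_m h_m = u P_(m-1)].  As for a
      Poisson law, [P] has [h]-mean [u] and [h]-variance at most
      [(1 + 2 mu) u] ([sum_dunkl_variance_le]).  The second moment of [b] is a
      constant, because [A] is analytic in a disc of radius greater than 1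
      ([appell_weight_moment2]).  For [k = m + r] the shape [s_k] differs from
      [h_m] by at most [r] plus a constant, which gives
      [n^2 sum_k w_k V_k = O(u + 1)].

    [Dstar_close] combines the last two, and letting [n] go to infinity and then
    [e] to 0 gives the theorem. *)

(** * The Gamma function *)

Section GammaFunction.
Context {R : realType}.
Implicit Types s t c x : R.
Notation leb := (@lebesgue_measure R).

(** Half of the exponential decay absorbs any power, by one term of the
    exponential series.  This yields both the integrability of the Gamma
    integrand and the vanishing of its boundary term at infinity. *)
Lemma powR_expR_bound s : 0 <= s ->
  exists2 K : R, 0 < K &
    forall t, 0 <= t -> t `^ s * expR (- t) <= K * expR (- (t / 2)).
Proof.
move=> s0.
pose N := (Num.bound s).+1.
have sN : s <= N%:R.
  rewrite /N; apply: (le_trans (ltW (archi_boundP s0))).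
  by rewrite ler_nat.
exists (1 + (2 ^+ N) * N`!%:R).
  by rewrite ltr_pwDl// mulr_ge0// ?exprn_ge0.
move=> t t0.
have t20 : 0 <= t / 2 by lra.
have -> : expR (- t) = expR (- (t / 2)) * expR (- (t / 2)).
  by rewrite -expRD; congr expR; lra.
rewrite mulrA ler_pM2r ?expR_gt0//.
rewrite {1}expRN ler_pdivrMr ?expR_gt0//.
have e1 : 1 <= expR (t / 2).
  by apply: le_trans (expR_ge1Dx _); rewrite lerDl.
have tN : t ^+ N <= 2 ^+ N * N`!%:R * expR (t / 2).
  have := @expR_ge1Dxn R (t / 2) N.-1 t20.
  rewrite /N/= -/N exprMn exprVn => H.
  have : (t ^+ N / 2 ^+ N) / N`!%:R <= expR (t / 2).
    by apply: le_trans H; rewrite lerDr.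
  rewrite ler_pdivrMr ?ltr0n ?fact_gt0// ler_pdivrMr ?exprn_gt0//.
  by move=> H1; apply: (le_trans H1); rewrite [leRHS](_ : _ = expR (t / 2) * N`!%:R * 2 ^+ N)//; ring.
rewrite mulrDl mul1r.
case: (leP t 1) => t1.
  apply: (@le_trans _ _ 1).
    case: (eqVneq t 0) => [->|tn0].
      by rewrite /powR eqxx; case: eqP => //= _; rewrite ler01.
    have <- : 1 `^ s = 1 :> R by rewrite powR1.
    by apply: ge0_ler_powR => //; rewrite ?nnegrE.
  apply: (le_trans e1); rewrite lerDl.
  by rewrite mulr_ge0 ?expR_ge0// mulr_ge0// exprn_ge0.
apply: (@le_trans _ _ (t ^+ N)).
  by rewrite -powR_mulrn//; apply: ler_powR => //; exact: ltW.
by apply: (le_trans tN); rewrite lerDr expR_ge0.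
Qed.

(** Euler's integral with extended real values, so that monotone convergence and
    the recurrence can be used before finiteness is known. *)
Definition gammaE s : \bar R :=
  (\int[leb]_(t in `]0%R:R, +oo[) (t `^ (s - 1) * expR (- t))%:E)%E.

Lemma continuous_gamma_integrand s :
  {in `]0%R:R, +oo[, continuous (fun t : R => t `^ (s - 1) * expR (- t))}.
Proof.
move=> t; rewrite in_itv/= andbT => t0.
apply: cvgM.
  have /derivable1_diffP/differentiable_continuous : derivable (@powR R ^~ (s - 1)) t 1.
    by apply: derivable_powR; rewrite in_itv/= andbT.
  by apply.
apply: continuous_comp; last exact: continuous_expR.
exact: cvgN.
Qed.

Lemma measurable_gamma_integrand s :
  measurable_fun `]0%R:R, +oo[ (fun t : R => t `^ (s - 1) * expR (- t)).
Proof.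
apply: open_continuous_measurable_fun => //.
by move=> t /[!inE] t0; apply: continuous_gamma_integrand.
Qed.

Lemma gamma_integrand_ge0 s (t : R) : 0 <= t `^ (s - 1) * expR (- t).
Proof. by rewrite mulr_ge0 ?powR_ge0 ?expR_ge0. Qed.

Lemma gammaE_ge0 s : (0 <= gammaE s)%E.
Proof. by apply: integral_ge0 => t _; rewrite lee_fin gamma_integrand_ge0. Qed.

(** For exponents below 1 the integrand is unbounded at 0, so that domination by
    an exponential density needs [1 <= s]; [gammaE_fin] reaches [0 < s] through
    the recurrence. *)
Lemma gammaE_fin_ge1 s : 1 <= s -> (gammaE s < +oo)%E.
Proof.
move=> s1; have [|K K0 HK] := powR_expR_bound (s - 1); first lra.
apply: (@le_lt_trans _ _
  (\int[leb]_(t in `]0%R:R, +oo[) (K * 2 * exponential_pdf (1/2) t)%:E)%E).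
  apply: ge0_le_integral => //=.
  - by move=> ? _; rewrite lee_fin gamma_integrand_ge0.
  - by apply/measurable_EFinP; exact: measurable_gamma_integrand.
  - apply/measurable_EFinP/measurable_funTS; apply: measurable_funM => //.
    exact: measurable_exponential_pdf.
  move=> t; rewrite in_itv/= andbT => t0; rewrite lee_fin.
  rewrite exponential_pdfE; last exact: ltW.
  apply: (le_trans (HK _ (ltW t0))); rewrite -!mulrA; rewrite ler_pM2l//.
  rewrite !mul1r mulrA divff// mul1r.
  by rewrite ler_expR; lra.
under eq_integral do rewrite EFinM.
rewrite ge0_integralZl_EFin//=; last 3 first.
- by move=> ? _; rewrite lee_fin; exact: exponential_pdf_ge0.
- by apply/measurable_EFinP/measurable_funTS; exact: measurable_exponential_pdf.
- by rewrite mulr_ge0// ltW.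
apply: lte_mul_pinfty => //; first by rewrite lee_fin mulr_ge0// ltW.
apply: (@le_lt_trans _ _ (\int[leb]_t (exponential_pdf (1 / 2) t)%:E)%E).
  apply: ge0_subset_integral => //=.
    by apply/measurable_EFinP; exact: measurable_exponential_pdf.
  by move=> ? _; rewrite lee_fin; exact: exponential_pdf_ge0.
by rewrite integral_exponential_pdf ?ltry//; lra.
Qed.

Lemma gammaE_gt0 s : 0 < s -> (0 < gammaE s)%E.
Proof.
move=> s0.
apply: (@lt_le_trans _ _ (\int[leb]_(t in `[1%R:R, 2%R:R]) (expR (- 2) / 2)%:E)%E).
  rewrite integral_cst//= lebesgue_measure_itv/= lte_fin ltr1n.
  by rewrite -EFinB -EFinM lte_fin mulr_gt0// ?divr_gt0 ?expR_gt0//; lra.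
apply: (@le_trans _ _
  (\int[leb]_(t in `[1%R:R, 2%R:R]) (t `^ (s - 1) * expR (- t))%:E)%E).
  apply: ge0_le_integral => //=.
  - apply/measurable_EFinP.
    apply: measurable_funS (measurable_gamma_integrand s) => //.
    by move=> t /=; rewrite !in_itv/= andbT => /andP[t1 _]; lra.
  - move=> t; rewrite in_itv/= => /andP[t1 t2]; rewrite lee_fin mulrC.
    apply: ler_pM; rewrite ?invr_ge0 ?expR_ge0//; last by rewrite ler_expR; lra.
    apply: (@le_trans _ _ (t `^ (- 1))); last by apply: ler_powR => //; lra.
    by rewrite powR_inv1 ?lef_pV2 ?posrE//; lra.
apply: ge0_subset_integral => //=.
- by apply/measurable_EFinP; exact: measurable_gamma_integrand.
- by move=> ? _; rewrite lee_fin gamma_integrand_ge0.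
- by move=> t /=; rewrite !in_itv/= andbT => /andP[t1 _]; lra.
Qed.

Lemma cvg_powR_expRN s : 0 <= s -> t `^ s * expR (- t) @[t --> +oo] --> (0 : R).
Proof.
move=> s0; have [K K0 HK] := powR_expR_bound s s0.
apply: (@squeeze_cvgr _ _ _ _ (fun=> 0) (fun t => K * expR (- (t / 2)))).
- near=> t; apply/andP; split; first by rewrite mulr_ge0 ?powR_ge0 ?expR_ge0.
  by apply: HK; near: t; apply: nbhs_pinfty_ge; rewrite num_real.
- exact: cvg_cst.
- rewrite -(mulr0 K); apply: cvgMr.
  apply: (@cvg_comp _ _ _ (fun t : R => t / 2) (fun t => expR (- t))); last exact: cvgr_expR.
  by apply: gt0_cvgMly => //; rewrite invr_gt0.
Unshelve. all: by end_near. Qed.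

Lemma cvg_powR0 s : 0 <= s -> t `^ s @[t --> 0^'+] --> (0 : R) `^ s.
Proof.
rewrite le_eqVlt => /predU1P[<-|s0].
  rewrite powRr0; under eq_fun do rewrite powRr0; exact: cvg_cst.
by rewrite powR0 ?gt_eqF//; exact: powR_cvg0.
Qed.

Lemma within_continuous_gamma_integrand s : 1 <= s ->
  {within `[0%R:R, +oo[, continuous (fun t : R => t `^ (s - 1) * expR (- t))}.
Proof.
move=> s1; apply/continuous_within_itvcyP; split.
  by move=> t t0; exact: continuous_gamma_integrand.
apply: cvgM; first by apply: cvg_powR0; lra.
by apply/cvg_at_right_filter; apply: continuous_comp; [exact: cvgN|exact: continuous_expR].
Qed.

(** The substitution [t -> c t].  It is only used for shapes at least 1, where
    the integrand is continuous up to 0. *)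
Lemma gammaE_scaled c s : 0 < c -> 1 <= s ->
  (\int[leb]_(t in `[0%R:R, +oo[) (expR (- (c * t)) * t `^ (s - 1))%:E =
   (c `^ s)^-1%:E * gammaE s)%E.
Proof.
move=> c0 s1.
have -> : gammaE s = (\int[leb]_(t in `[0%R:R, +oo[) (t `^ (s - 1) * expR (- t))%:E)%E.
  rewrite /gammaE integral_itv_obnd_cbnd//.
  by apply/measurable_EFinP; exact: measurable_gamma_integrand.
pose F := fun t : R => c * t.
have F'E : F^`()%classic = cst c.
  by apply/funext => t; rewrite derive1E /F derive_val scaler1.
have := @increasing_ge0_integration_by_substitutiony R F
  (fun t : R => t `^ (s - 1) * expR (- t)) 0.
rewrite /F mulr0 -/F => ->; last 8 first.
- by move=> x y _ _ xy; rewrite ltr_pM2l.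
- by move=> x _; rewrite F'E; exact: (cvg_cst c).
- by rewrite F'E; exact: is_cvg_cst.
- by rewrite F'E; exact: is_cvg_cst.
- split; first by move=> ? _; exact: ex_derive.
  by apply/cvg_at_right_filter; apply: cvgMr; exact: cvg_id.
- exact: gt0_cvgMry.
- exact: within_continuous_gamma_integrand.
- by move=> t _; exact: gamma_integrand_ge0.
have -> : (\int[leb]_(x in `[0%R:R, +oo[) ((((fun t : R => t `^ (s - 1) * expR (- t)) \o F) *
    F^`()%classic) x)%:E = \int[leb]_(x in `[0%R:R, +oo[)
    ((c `^ s)%:E * (expR (- (c * x)) * x `^ (s - 1))%:E))%E.
  apply: eq_integral => x; rewrite inE/= in_itv/= andbT => x0.
  rewrite F'E /F/= -EFinM; congr EFin.
  have -> : c `^ s = c * c `^ (s - 1) by rewrite mulr_powRB1//; lra.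
  rewrite [LHS](_ : _ = (c * x) `^ (s - 1) * expR (- (c * x)) * c)//.
  rewrite powRM//; [ring|exact: ltW].
rewrite ge0_integralZl_EFin//=.
- by rewrite muleA -EFinM mulVf ?mul1e// gt_eqF ?powR_gt0.
- by move=> ? _; rewrite lee_fin mulr_ge0 ?expR_ge0 ?powR_ge0.
- apply/measurable_EFinP/measurable_funTS; apply: measurable_funM => //.
  by apply: measurableT_comp => //; apply: measurableT_comp => //; exact: measurable_funM.
- exact: powR_ge0.
Qed.

Let leftn (n : nat) : R := n.+2%:R^-1.
Let rightn (n : nat) : R := n.+2%:R.

(** The intervals stay away from 0 because [t `^ (s - 1)] may be singular there. *)
Let gammaE_trunc s : (fun n => \int[leb]_(t in `[leftn n, rightn n])
  (t `^ (s - 1) * expR (- t))%:E)%E @ \oo --> gammaE s.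
Proof.
have sub n : `[leftn n, rightn n] `<=` `]0%R:R, +oo[.
  move=> x /=; rewrite !in_itv/= andbT => /andP[+ _]; apply: lt_le_trans.
  by rewrite /leftn invr_gt0.
rewrite /gammaE.
have -> : `]0%R:R, +oo[%classic = \bigcup_n `[leftn n, rightn n]%classic.
  apply/seteqP; split => [x /=|x [n _]]; last exact: sub.
  rewrite in_itv/= andbT => x0.
  exists (Num.bound x + Num.bound x^-1)%N => //=; rewrite in_itv/= /leftn /rightn.
  apply/andP; split.
    rewrite invf_ple ?posrE//; apply/ltW/(lt_le_trans (archi_boundP _)).
      by rewrite invr_ge0 ltW.
    by rewrite ler_nat -addn2 -addnA addnCA leq_addr.
  apply/ltW/(lt_le_trans (archi_boundP (ltW x0))).
  by rewrite ler_nat -addn2 -addnA leq_addr.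
apply: ge0_nondecreasing_set_cvg_integral => //.
- apply/nondecreasing_seqP => n; rewrite subsetEset => x /=.
  rewrite !in_itv/= => /andP[h1 h2]; apply/andP; split.
    by apply: le_trans h1; rewrite lef_pV2 ?posrE// ler_nat.
  by apply: (le_trans h2); rewrite ler_nat.
- move=> n; apply/measurable_EFinP.
  exact: measurable_funS (sub n) (measurable_gamma_integrand s).
- by move=> n x _; rewrite lee_fin gamma_integrand_ge0.
Qed.

(** Integration by parts on the truncated intervals; the boundary terms vanish in
    the limit.  The identity holds in the extended reals, before either side is
    known to be finite. *)
Lemma gammaE_rec s : 0 < s -> (gammaE (s + 1) = s%:E * gammaE s)%E.
Proof.
move=> s0.
pose bd (n : nat) : R := leftn n `^ s * expR (- leftn n) - rightn n `^ s * expR (- rightn n).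
have ln0 n : 0 < leftn n by rewrite invr_gt0.
have lr n : leftn n < rightn n.
  apply: (@lt_trans _ _ 1); last by rewrite ltr1n.
  by rewrite invf_lt1 ?ltr1n.
(* The antiderivative of [expR (- t)] is taken negative, whence the order of the
   boundary terms in [bd]. *)
have byparts n : (\int[leb]_(t in `[leftn n, rightn n]) (t `^ (s + 1 - 1) * expR (- t))%:E
  = (bd n)%:E + s%:E * \int[leb]_(t in `[leftn n, rightn n]) (t `^ (s - 1) * expR (- t))%:E)%E.
  have pos t : leftn n <= t -> 0 < t by exact: lt_le_trans.
  have cpow p t : leftn n <= t -> {for t, continuous (@powR R ^~ p)}.
    move=> /pos t0; apply/differentiable_continuous/derivable1_diffP.
    by apply: derivable_powR; rewrite in_itv/= andbT.
  have cexp (t : R) : {for t, continuous (fun t : R => expR (- t))}.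
    by apply: continuous_comp; [exact: cvgN|exact: continuous_expR].
  rewrite addrK.
  rewrite (@integration_by_parts R (fun t => t `^ s) (fun t => - expR (- t))
     (fun t => s * t `^ (s - 1)) (fun t => expR (- t))) //=.
  - under eq_integral do rewrite mulrN -mulrA -mulNr EFinM.
    rewrite integralZl//=; last first.
      apply: continuous_compact_integrable; first exact: segment_compact.
      apply: continuous_in_subspaceT => t /[!inE]/=; rewrite in_itv/= => /andP[t1 _].
      by apply: cvgM; [exact: cpow|exact: cexp].
    rewrite EFinN mulNe oppeK; congr (_%:E + _)%E.
    by rewrite /bd !mulrN opprK addrC.
  - apply: continuous_in_subspaceT => t /[!inE]/=; rewrite in_itv/= => /andP[t1 _].
    by apply: cvgMr; exact: cpow.
  - split.
    + move=> t; rewrite in_itv/= => /andP[/ltW/pos t0 _].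
      by apply: derivable_powR; rewrite in_itv/= andbT.
    + by apply/cvg_at_right_filter; exact: cpow.
    + by apply/cvg_at_left_filter; apply: cpow; exact: ltW.
  - move=> t; rewrite in_itv/= => /andP[/ltW/pos t0 _].
    by rewrite powR_derive1// in_itv/= andbT.
  - by apply: continuous_subspaceT => t; exact: cexp.
  - split.
    + by move=> t _; exact: ex_derive.
    + by apply/cvg_at_right_filter; apply: cvgN; exact: cexp.
    + by apply/cvg_at_left_filter; apply: cvgN; exact: cexp.
  - by move=> t _; rewrite derive1E derive_val mulrN1 opprK.
have rightoo : rightn n @[n --> \oo] --> +oo.
  rewrite /rightn; under eq_fun do rewrite -addn2.
  by apply: (cvg_comp (addn^~ 2%N) (fun n => n%:R)); [exact: cvg_addnr|exact: cvgr_idn].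
have bd0 : bd n @[n --> \oo] --> (0 : R).
  rewrite -[X in _ --> X](subr0 0); apply: cvgB; last first.
    exact: (cvg_comp rightn _ rightoo (cvg_powR_expRN s (ltW s0))).
  have left0 : leftn n @[n --> \oo] --> (0 : R).
    by have := @cvg_harmonic R; rewrite -cvg_shiftS.
  have left0p : leftn n @[n --> \oo] --> 0^'+.
    move=> A /left0 h.
    have {}h : \forall n \near \oo, 0 < leftn n -> A (leftn n) by exact: h.
    have : \forall n \near \oo, A (leftn n) by apply: filterS h => n; apply; exact: ln0.
    by [].
  have e0 : expR (- leftn n) @[n --> \oo] --> expR (- 0 : R).
    apply: (cvg_comp leftn (fun t => expR (- t)) left0).
    by apply: continuous_comp; [exact: cvgN|exact: continuous_expR].
  suff : leftn n `^ s * expR (- leftn n) @[n --> \oo] --> 0 * expR (- 0 : R).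
    by rewrite mul0r.
  apply: cvgM e0; exact: (cvg_comp leftn _ left0p (powR_cvg0 s0)).
have c1 : ((bd n)%:E @[n --> \oo] --> 0%:E)%E by apply: cvg_EFin => //; exact: nearW.
have c2 := cvgeZl (isT : (s%:E \is a fin_num)%E) (gammaE_trunc s).
have dd : (0%:E +? s%:E * gammaE s)%E by rewrite fin_num_adde_defr.
have c3 := cvgeD dd c1 c2.
have c4 := gammaE_trunc (s + 1).
rewrite -(cvg_lim _ c4)// -[RHS]add0e -(cvg_lim _ (c3 _))//.
by congr (limn _); apply/funext => n; exact: byparts.
Unshelve. all: by end_near. Qed.

(** [s + 1] lies in the range where domination applies, and the recurrence brings
    finiteness back to [s]. *)
Lemma gammaE_fin s : 0 < s -> gammaE s \is a fin_num.
Proof.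
move=> s0; rewrite ge0_fin_numE ?gammaE_ge0//.
have : (gammaE (s + 1) < +oo)%E by apply: gammaE_fin_ge1; lra.
rewrite gammaE_rec// lt_neqAle leey andbT.
by have := leey (gammaE s); rewrite le_eqVlt => /predU1P[->|//]; rewrite gt0_muley ?lte_fin// eqxx.
Qed.

Lemma EFin_Gamma s : 0 < s -> (Gamma s)%:E = gammaE s.
Proof. by move=> s0; rewrite -[RHS]fineK ?gammaE_fin. Qed.

Lemma Gamma_gt0 s : 0 < s -> 0 < Gamma s.
Proof. by move=> s0; rewrite -lte_fin EFin_Gamma ?gammaE_gt0. Qed.

Lemma Gamma_rec s : 0 < s -> Gamma (s + 1) = s * Gamma s.
Proof.
move=> s0; apply: EFin_inj.
by rewrite EFinM !EFin_Gamma// ?gammaE_rec//; lra.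
Qed.

End GammaFunction.

(** * Averages against a gamma law *)

Section GammaMean.
Context {R : realType}.
Implicit Types s t c x : R.
Notation leb := (@lebesgue_measure R).


(** Unnormalized density of the gamma law of shape [s] and rate [c]. *)
Definition gamma_kernel c s (t : R) : R := expR (- (c * t)) * t `^ (s - 1).

(** Expectation of [f] under the gamma law of shape [s] and rate [c]. *)
Definition gamma_mean c s (f : R -> R) : R :=
  c `^ s / Gamma s * \int[leb]_(t in `[0%R:R, +oo[) (gamma_kernel c s t * f t).

Lemma gamma_kernel_ge0 c s t : 0 <= gamma_kernel c s t.
Proof. by rewrite mulr_ge0 ?expR_ge0 ?powR_ge0. Qed.

Lemma measurable_gamma_kernel c s (D : set R) : measurable_fun D (gamma_kernel c s).
Proof.
apply: measurable_funTS; apply: measurable_funM => //.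
by apply: measurableT_comp => //; apply: measurableT_comp => //; exact: measurable_funM.
Qed.

Lemma gamma_kernel_integrable c s : 0 < c -> 1 <= s ->
  leb.-integrable `[0%R:R, +oo[ (EFin \o gamma_kernel c s).
Proof.
move=> c0 s1; apply/integrableP; split.
  by apply/measurable_EFinP; exact: measurable_gamma_kernel.
under eq_integral do rewrite /= ger0_norm ?gamma_kernel_ge0//.
rewrite gammaE_scaled// -EFin_Gamma; last lra.
by rewrite -EFinM ltry.
Qed.

Lemma Rintegral_gamma_kernel c s : 0 < c -> 1 <= s ->
  \int[leb]_(t in `[0%R:R, +oo[) gamma_kernel c s t = Gamma s / c `^ s.
Proof.
move=> c0 s1; rewrite /Rintegral gammaE_scaled// -EFin_Gamma; last lra.
by rewrite -EFinM/= mulrC.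
Qed.

Lemma gamma_kernelM c s t : 0 < s -> 0 <= t ->
  gamma_kernel c s t * t = gamma_kernel c (s + 1) t.
Proof.
move=> s0 t0; rewrite /gamma_kernel -mulrA; congr (_ * _).
by rewrite mulrC mulr_powRB1// addrK.
Qed.

(** Multiplying the kernel by [t] raises its shape by one, so that the moments are
    values of Gamma at shifted arguments. *)
Lemma gamma_kernel_quad c s (p q r : R) t : 0 < s -> 0 <= t ->
  gamma_kernel c s t * (p + q * t + r * t ^+ 2) =
  p * gamma_kernel c s t + q * gamma_kernel c (s + 1) t
  + r * gamma_kernel c (s + 1 + 1) t.
Proof.
move=> s0 t0.
rewrite -(gamma_kernelM _ (s + 1))//; last lra.
rewrite -!gamma_kernelM//; ring.
Qed.

Let integrable_mulk c s (p : R) : 0 < c -> 1 <= s ->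
  leb.-integrable `[0%R:R, +oo[ (EFin \o (fun t => p * gamma_kernel c s t)).
Proof.
move=> c0 s1.
apply: (@integrableZl _ _ _ leb _ _ p (EFin \o gamma_kernel c s)) => //.
exact: gamma_kernel_integrable.
Qed.

Lemma integrable_gamma_quad c s (p q r : R) : 0 < c -> 1 <= s ->
  leb.-integrable `[0%R:R, +oo[
    (EFin \o (fun t => gamma_kernel c s t * (p + q * t + r * t ^+ 2))).
Proof.
move=> c0 s1.
have s2 : 1 <= s + 1 by lra.
have s3 : 1 <= s + 1 + 1 by lra.
apply: (@eq_integrable _ _ _ leb _ _ (EFin \o (fun t => p * gamma_kernel c s t
  + q * gamma_kernel c (s + 1) t + r * gamma_kernel c (s + 1 + 1) t))) => //.
  move=> t; rewrite inE/= in_itv/= andbT => t0.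
  by rewrite gamma_kernel_quad//; lra.
apply: (@integrableD _ _ _ leb _ _
  (EFin \o (fun t => p * gamma_kernel c s t + q * gamma_kernel c (s + 1) t))
  (EFin \o (fun t => r * gamma_kernel c (s + 1 + 1) t))) => //; last exact: integrable_mulk.
by apply: (@integrableD _ _ _ leb _ _ (EFin \o (fun t => p * gamma_kernel c s t))
  (EFin \o (fun t => q * gamma_kernel c (s + 1) t))) => //; exact: integrable_mulk.
Qed.

Lemma gamma_mean_quad c s (p q r : R) : 0 < c -> 1 <= s ->
  gamma_mean c s (fun t => p + q * t + r * t ^+ 2) =
  p + q * (s / c) + r * (s * (s + 1) / c ^+ 2).
Proof.
move=> c0 s1; rewrite /gamma_mean.
have s2 : 1 <= s + 1 by lra.
have s3 : 1 <= s + 1 + 1 by lra.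
have -> : \int[leb]_(t in `[0%R:R, +oo[) (gamma_kernel c s t * (p + q * t + r * t ^+ 2))
  = \int[leb]_(t in `[0%R:R, +oo[) (p * gamma_kernel c s t
  + q * gamma_kernel c (s + 1) t + r * gamma_kernel c (s + 1 + 1) t).
  apply: eq_Rintegral => t; rewrite inE/= in_itv/= andbT => t0.
  by rewrite gamma_kernel_quad//; lra.
rewrite RintegralD//=; last 2 first.
- apply: (@integrableD _ _ _ leb _ _ (EFin \o (fun t => p * gamma_kernel c s t))
    (EFin \o (fun t => q * gamma_kernel c (s + 1) t))) => //; exact: integrable_mulk.
- exact: integrable_mulk.
rewrite RintegralD//=; last 2 first.
- exact: integrable_mulk.
- exact: integrable_mulk.
rewrite !RintegralZl//=; try exact: gamma_kernel_integrable.
rewrite !Rintegral_gamma_kernel//.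
have s0 : 0 < s by lra.
rewrite (Gamma_rec (s + 1)) ?(Gamma_rec s)//; last lra.
have G0 := lt0r_neq0 (Gamma_gt0 s s0).
have cs0 : c `^ s != 0 by rewrite gt_eqF ?powR_gt0.
have cS u : c `^ (u + 1) = c `^ u * c.
  by rewrite powRD ?powRr1 ?ltW// (gt_eqF c0) implybT.
rewrite !cS.
by field; rewrite cs0 G0 gt_eqF.
Qed.

(** The coefficient of [C] is the second moment about [x] of the gamma law,
    variance plus squared bias.  Comparing [f] with the two quadratics
    [y + (e + C (t - x)^2)] and [y - (e + C (t - x)^2)] avoids integrating an
    absolute value. *)
Lemma gamma_mean_close c s (f : R -> R) (y x e C : R) : 0 < c -> 1 <= s ->
  {within `[0%R:R, +oo[, continuous f} -> 0 <= e -> 0 <= C ->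
  (forall t, 0 <= t -> `|f t - y| <= e + C * (t - x) ^+ 2) ->
  `|gamma_mean c s f - y| <= e + C * (s / c ^+ 2 + (s / c - x) ^+ 2).
Proof.
move=> c0 s1 cf e0 C0 fE.
have s0 : 0 < s by lra.
have mf : measurable_fun `[0%R:R, +oo[ f by exact: subspace_continuous_measurable_fun.
have fdom (t : R) : 0 <= t ->
    `|f t| <= `|y| + e + C * x ^+ 2 + - (2 * C * x) * t + C * t ^+ 2.
  move=> t0; rewrite [leRHS](_ : _ = `|y| + (e + C * (t - x) ^+ 2)); last by ring.
  rewrite -{1}(subrK y (f t)) addrC.
  by apply: (le_trans (ler_normD _ _)); rewrite lerD2l; exact: fE.
have intf : leb.-integrable `[0%R:R, +oo[ (EFin \o (fun t => gamma_kernel c s t * f t)).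
  apply: le_integrable _ _ (integrable_gamma_quad c s
    (`|y| + e + C * x ^+ 2) (- (2 * C * x)) C c0 s1) => //.
    by apply/measurable_EFinP; apply: measurable_funM => //; exact: measurable_gamma_kernel.
  move=> t; rewrite /= in_itv/= andbT => t0; rewrite lee_fin !normrM.
  by apply: ler_wpM2l => //; apply: le_trans (ler_norm _); exact: fdom.
have K0 : 0 <= c `^ s / Gamma s by rewrite divr_ge0 ?powR_ge0// ltW// Gamma_gt0.
have up : gamma_mean c s f <= gamma_mean c s
   (fun t => (y + e + C * x ^+ 2) + (- (2 * C * x)) * t + C * t ^+ 2).
  apply: ler_wpM2l => //; apply: le_Rintegral => //; first exact: integrable_gamma_quad.
  move=> t; rewrite /= in_itv/= andbT => t0.
  apply: ler_wpM2l; first exact: gamma_kernel_ge0.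
  by have := fE t t0; rewrite ler_norml => /andP[_]; lra.
have lo : gamma_mean c s (fun t => (y - e - C * x ^+ 2) + (2 * C * x) * t + (- C) * t ^+ 2)
   <= gamma_mean c s f.
  apply: ler_wpM2l => //; apply: le_Rintegral => //; first exact: integrable_gamma_quad.
  move=> t; rewrite /= in_itv/= andbT => t0.
  apply: ler_wpM2l; first exact: gamma_kernel_ge0.
  by have := fE t t0; rewrite ler_norml => /andP[+ _]; lra.
move: up lo; rewrite !gamma_mean_quad// => up lo.
have E : s / c ^+ 2 + (s / c - x) ^+ 2 = s * (s + 1) / c ^+ 2 - 2 * x * (s / c) + x ^+ 2.
  by field; rewrite gt_eqF.
rewrite E ler_norml; apply/andP; split; lra.
Qed.
End GammaMean.

(** * Cauchy products of nonnegative series *)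

Section SeriesBounds.
Context {R : realType}.
Implicit Types (u v p q w : nat -> R).

Lemma ge0_series_le_lim u (l : R) n : (forall k, 0 <= u k) ->
  series u @ \oo --> l -> series u n <= l.
Proof.
move=> u0 ul; rewrite -(cvg_lim _ ul)//.
apply: nondecreasing_cvgn_le; last by apply/cvg_ex; exists l.
by apply/nondecreasing_seqP => m; rewrite /series/= big_nat_recr//= lerDl.
Qed.

(** Summation of [G] over the pairs with [m + r < N], along antidiagonals on the
    left and along rows on the right. *)
Lemma triangle_sum (G : nat -> nat -> R) N :
  \sum_(0 <= k < N) \sum_(m < k.+1) G m (k - m)%N =
  \sum_(0 <= m < N) \sum_(0 <= r < N - m) G m r.
Proof.
elim: N => [|N IH]; first by rewrite !big_nil.
rewrite big_nat_recr//= IH big_ord_recr/= subnn.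
rewrite [RHS]big_nat_recr//= subSnn big_nat1 addrA; congr (_ + _).
rewrite -(big_mkord predT (fun m => G m (N - m)%N)) -big_split/=.
apply: eq_big_nat => m /andP[_ mN].
by rewrite subSn ?(ltnW mN)// big_nat_recr.
Qed.

Definition cauchy_prod p q k : R := \sum_(m < k.+1) p m * q (k - m)%N.

Lemma cauchy_prod_ge0 p q k : (forall m, 0 <= p m) -> (forall m, 0 <= q m) -> 0 <= cauchy_prod p q k.
Proof. by move=> p0 q0; apply: sumr_ge0 => m _; rewrite mulr_ge0. Qed.

Lemma ge0_sum_nat_widen u N M : (forall k, 0 <= u k) -> (N <= M)%N ->
  \sum_(0 <= k < N) u k <= \sum_(0 <= k < M) u k.
Proof.
move=> u0 NM; rewrite [leRHS](big_cat_nat (leq0n N) NM)/= lerDl.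
by apply: sumr_ge0.
Qed.

Lemma triangle_le_square (G : nat -> nat -> R) N : (forall m r, 0 <= G m r) ->
  \sum_(0 <= k < N) \sum_(m < k.+1) G m (k - m)%N <=
  \sum_(0 <= m < N) \sum_(0 <= r < N) G m r.
Proof.
move=> G0; rewrite triangle_sum; apply: ler_sum => m _.
by apply: ge0_sum_nat_widen => //; exact: leq_subr.
Qed.

Lemma square_le_triangle (G : nat -> nat -> R) N : (forall m r, 0 <= G m r) ->
  \sum_(0 <= m < N) \sum_(0 <= r < N) G m r <=
  \sum_(0 <= k < N + N) \sum_(m < k.+1) G m (k - m)%N.
Proof.
move=> G0; rewrite triangle_sum.
apply: (@le_trans _ _ (\sum_(0 <= m < N) \sum_(0 <= r < N + N - m) G m r)).
  rewrite !big_nat; apply: ler_sum => m /andP[_ mN].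
  by apply: ge0_sum_nat_widen => //; rewrite -addnBA ?leq_addr// ltnW.
apply: (@ge0_sum_nat_widen (fun m => \sum_(0 <= r < N + N - m) G m r)).
  by move=> k; exact: sumr_ge0.
exact: leq_addr.
Qed.

(** For nonnegative terms the triangle [m + r < 2N] lies between the square of
    side [N] and the square of side [2N], so that the Cauchy product converges
    by squeezing. *)
Lemma cvg_series_cauchy_prod p q (a b : R) : (forall m, 0 <= p m) -> (forall m, 0 <= q m) ->
  series p @ \oo --> a -> series q @ \oo --> b ->
  series (cauchy_prod p q) @ \oo --> a * b.
Proof.
move=> p0 q0 pa qb.
have G0 m r : 0 <= p m * q r by rewrite mulr_ge0.
have sqE N : \sum_(0 <= m < N) \sum_(0 <= r < N) p m * q r = series p N * series q N.
  by rewrite /series/= mulr_suml; apply: eq_bigr => m _; rewrite mulr_sumr.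
have ub N : series (cauchy_prod p q) N <= a * b.
  apply: (le_trans (triangle_le_square _ _ G0)); rewrite sqE.
  by apply: ler_pM; rewrite ?sumr_ge0//; exact: ge0_series_le_lim.
have nd : nondecreasing_seq (series (cauchy_prod p q)).
  apply/nondecreasing_seqP => m; rewrite /series/= big_nat_recr//= lerDl.
  exact: cauchy_prod_ge0.
have cv : cvgn (series (cauchy_prod p q)).
  by apply: nondecreasing_is_cvgn => //; exists (a * b) => _ [n _ <-].
suff -> : a * b = limn (series (cauchy_prod p q)) by [].
apply/eqP; rewrite eq_le; apply/andP; split; last first.
  by apply: limr_le => //; exact: nearW.
rewrite -(cvg_lim _ (cvgM pa qb))//; apply: limr_le.
  by apply/cvg_ex; exists (a * b); exact: cvgM.
apply: nearW => N; rewrite -[leLHS]/(series p N * series q N) -sqE.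
apply: (le_trans (square_le_triangle _ _ G0)).
exact: nondecreasing_cvgn_le nd cv (N + N)%N.
Qed.

(** In probabilistic terms: if [X] and [Y] are independent with laws [p] and [q],
    then [E V(X + Y) <= E al(X) + E be(Y)].  All hypotheses concern partial sums,
    so that no convergence of the weighted series is needed. *)
Lemma cauchy_prod_weighted_le p q (V al be : nat -> R) (A B : R) N :
  (forall m, 0 <= p m) -> (forall m, 0 <= q m) ->
  series p @ \oo --> (1 : R) -> series q @ \oo --> (1 : R) ->
  (forall m, 0 <= al m) -> (forall r, 0 <= be r) ->
  (forall m r, V (m + r)%N <= al m + be r) ->
  (forall n, \sum_(0 <= m < n) p m * al m <= A) ->
  (forall n, \sum_(0 <= r < n) q r * be r <= B) ->
  \sum_(0 <= k < N) cauchy_prod p q k * V k <= A + B.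
Proof.
move=> p0 q0 p1 q1 al0 be0 Vle HA HB.
apply: (@le_trans _ _ (\sum_(0 <= k < N) \sum_(m < k.+1)
   p m * q (k - m)%N * (al m + be (k - m)%N))).
  apply: ler_sum => k _; rewrite /cauchy_prod mulr_suml; apply: ler_sum => m _.
  apply: ler_wpM2l; first by rewrite mulr_ge0.
  by apply: le_trans (Vle _ _); rewrite subnKC// -ltnS.
apply: (le_trans (@triangle_le_square (fun m r => p m * q r * (al m + be r)) N _)).
  by move=> m r; rewrite !mulr_ge0 ?addr_ge0.
have -> : \sum_(0 <= m < N) \sum_(0 <= r < N) p m * q r * (al m + be r) =
   (\sum_(0 <= m < N) p m * al m) * series q N + series p N * (\sum_(0 <= r < N) q r * be r).
  rewrite /series/= !mulr_suml -big_split/=; apply: eq_bigr => m _.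
  rewrite !mulr_sumr -big_split/=; apply: eq_bigr => r _; ring.
have sp : series p N <= 1 by exact: ge0_series_le_lim.
have sq : series q N <= 1 by exact: ge0_series_le_lim.
apply: lerD.
  apply: le_trans (HA N); apply: ler_piMr => //.
  by apply: sumr_ge0 => m _; rewrite mulr_ge0.
apply: le_trans (HB N); apply: ler_piMl => //.
by apply: sumr_ge0 => m _; rewrite mulr_ge0.
Qed.

(** The bound also makes the series of the [w k * (I k - y)] absolutely
    convergent, so that the limit exists and is not just a formal value. *)
Lemma cvg_series_weighted_mean w (I V : nat -> R) (y e C W : R) :
  (forall k, 0 <= w k) -> series w @ \oo --> (1 : R) -> 0 <= e -> 0 <= C ->
  (forall k, `|I k - y| <= e + C * V k) ->
  (forall N, \sum_(0 <= k < N) w k * V k <= W) ->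
  exists2 l, series (fun k => w k * I k) @ \oo --> l & `|l - y| <= e + C * W.
Proof.
move=> w0 w1 e0 C0 HI HV.
pose d k := w k * (I k - y).
have nb N : \sum_(0 <= k < N) `|d k| <= e + C * W.
  apply: (@le_trans _ _ (e * series w N + C * \sum_(0 <= k < N) w k * V k)).
    rewrite /series/= !mulr_sumr -big_split/=; apply: ler_sum => k _.
    rewrite /d normrM ger0_norm// [leRHS](_ : _ = w k * (e + C * V k)); last ring.
    exact: ler_wpM2l.
  apply: lerD; last exact: ler_wpM2l.
  by rewrite ler_piMr//; exact: ge0_series_le_lim.
have cd : cvgn (series d).
  apply: normed_cvg; apply: nondecreasing_is_cvgn.
    by apply: nondecreasing_series => n _ _; exact: normr_ge0.
  by exists (e + C * W) => _ [n _ <-]; exact: nb.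
exists (limn (series d) + y * 1).
  have -> : series (fun k => w k * I k) = (fun n => series d n + y * series w n).
    apply/funext => n; rewrite /series/= mulr_sumr -big_split/=.
    by apply: eq_bigr => k _; rewrite /d; ring.
  by apply: cvgD => //; apply: cvgMr.
rewrite mulr1 addrK.
have cn : `|series d n| @[n --> \oo] --> `|limn (series d)| by exact: cvg_norm.
rewrite -(cvg_lim _ cn)//; apply: limr_le; first by apply/cvg_ex; eexists; exact: cn.
by apply: nearW => n; apply: le_trans (nb n); exact: ler_norm_sum.
Qed.

End SeriesBounds.

(** * The law attached to the Dunkl exponential *)

Section DunklWeights.
Context {R : realType}.
Variable mu : R.
Hypothesis mu0 : 0 <= mu.

(** The Dunkl analogue of the integer [k]: the ratio of consecutive coefficients
    [gamma_dunkl]. *)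
Definition dunkl_nat k : R := k%:R + 2 * mu * theta k.

Lemma gamma_dunkl0 : gamma_dunkl mu 0 = 1.
Proof.
rewrite /gamma_dunkl/= muln0 expr0 fact0 !mul1r add0r divff// gt_eqF//.
apply: Gamma_gt0; have := mu0; lra.
Qed.

(** Both parities reduce to the recurrence of Gamma: for odd [k.+1] it is applied
    to the Gamma factor, for even [k.+1] the new factor comes from the factorial. *)
Lemma gamma_dunkl_rec k :
  gamma_dunkl mu k.+1 = dunkl_nat k.+1 * gamma_dunkl mu k.
Proof.
have m0 := mu0.
rewrite /dunkl_nat /theta /gamma_dunkl /=.
rewrite -[in k.+1%:R](odd_double_half k) uphalf_half.
set j := k./2; have j0 : 0 <= j%:R :> R by [].
have G0 : Gamma (mu + 1 / 2) != 0 by rewrite gt_eqF//; apply: Gamma_gt0; lra.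
(* Half-integer shifts: [3 / 2] is [1 / 2 + 1]. *)
have Gr : Gamma (j%:R + mu + 3 / 2) = (j%:R + mu + 1 / 2) * Gamma (j%:R + mu + 1 / 2).
  by rewrite -Gamma_rec; [congr Gamma; lra|lra].
move: (Gamma (mu + 1 / 2)) G0 => g g0.
case: (odd k) => /=.
  rewrite !add1n factS (_ : (2 * j.+1 = 2 * j + 1 + 1)%N); last by rewrite mulnS addnC -addnA.
  rewrite exprD expr1.
  rewrite (_ : j.+1%:R + mu + 1 / 2 = j%:R + mu + 3 / 2); last by rewrite -[j.+1%:R]natr1; lra.
  move: (Gamma (j%:R + mu + 3 / 2)) => g'.
  rewrite -muln2 -[(j * 2).+2%:R]natr1 -[(j * 2).+1%:R]natr1 !natrM -[j.+1%:R]natr1.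
  by field.
rewrite !add0n Gr exprD expr1 -muln2 -[(j * 2).+1%:R]natr1 natrM.
move: (Gamma (j%:R + mu + 1 / 2)) => g'.
by field.
Qed.

Lemma dunkl_nat_ge k : k%:R <= dunkl_nat k.
Proof. by rewrite /dunkl_nat /theta lerDl !mulr_ge0. Qed.

Lemma dunkl_nat_ge0 k : 0 <= dunkl_nat k.
Proof. exact: le_trans (dunkl_nat_ge k). Qed.

Lemma theta01 k : 0 <= (theta k : R) <= 1.
Proof. by rewrite /theta; case: (odd k); rewrite lexx ler01. Qed.

Lemma dunkl_natS k : dunkl_nat k.+1 <= dunkl_nat k + (1 + 2 * mu).
Proof.
have m0 := mu0.
rewrite /dunkl_nat -natr1.
have /andP[a0 a1] := theta01 k; have /andP[b0 b1] := theta01 k.+1.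
have : 2 * mu * theta k.+1 <= 2 * mu by rewrite ler_piMr// mulr_ge0.
have : 0 <= 2 * mu * theta k by rewrite !mulr_ge0.
lra.
Qed.

Lemma dunkl_nat_shift m r : `|dunkl_nat (m + r) - dunkl_nat m| <= r%:R + 2 * mu.
Proof.
have m0 := mu0.
rewrite /dunkl_nat natrD.
have /andP[a0 a1] := theta01 (m + r); have /andP[b0 b1] := theta01 m.
have : 2 * mu * theta (m + r) <= 2 * mu by rewrite ler_piMr// mulr_ge0.
have : 0 <= 2 * mu * theta (m + r) by rewrite !mulr_ge0.
have : 2 * mu * theta m <= 2 * mu by rewrite ler_piMr// mulr_ge0.
have : 0 <= 2 * mu * theta m by rewrite !mulr_ge0.
have : 0 <= r%:R :> R by [].
rewrite ler_norml => *; apply/andP; split; lra.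
Qed.

(** Comparison with the factorial makes the Dunkl exponential converge
    everywhere, by comparison with the exponential series. *)
Lemma gamma_dunkl_ge_fact k : k`!%:R <= gamma_dunkl mu k.
Proof.
elim: k => [|k IH]; first by rewrite gamma_dunkl0.
rewrite gamma_dunkl_rec factS natrM; apply: ler_pM => //.
exact: dunkl_nat_ge.
Qed.

Lemma gamma_dunkl_gt0 k : 0 < gamma_dunkl mu k.
Proof. by apply: lt_le_trans (gamma_dunkl_ge_fact k); rewrite ltr0n fact_gt0. Qed.

Lemma cvg_exp_dunkl x : 0 <= x ->
  pseries (fun k => (gamma_dunkl mu k)^-1) x @ \oo --> exp_dunkl mu x.
Proof.
move=> x0.
suff : cvgn (pseries (fun k => (gamma_dunkl mu k)^-1) x) by [].
apply: series_le_cvg (is_cvg_series_exp_coeff x).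
- by move=> n; rewrite mulr_ge0 ?exprn_ge0// invr_ge0 ltW// gamma_dunkl_gt0.
- by move=> n; exact: exp_coeff_ge0.
- move=> n; rewrite /exp_coeff/= mulrC ler_wpM2l ?exprn_ge0//.
  by rewrite lef_pV2 ?gamma_dunkl_ge_fact// posrE ?gamma_dunkl_gt0// ltr0n fact_gt0.
Qed.

Lemma exp_dunkl_gt0 x : 0 <= x -> 0 < exp_dunkl mu x.
Proof.
move=> x0; apply: (@lt_le_trans _ _ (pseries (fun k => (gamma_dunkl mu k)^-1) x 1)).
  by rewrite /pseries/series/= big_nat1 gamma_dunkl0 expr0 mulr1 invr1.
apply: (ge0_series_le_lim _ _ _ _ (cvg_exp_dunkl x x0)) => k.
by rewrite mulr_ge0 ?exprn_ge0// invr_ge0 ltW// gamma_dunkl_gt0.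
Qed.

(** A probability law on the integers, the Poisson law of parameter [x] when
    [mu = 0]. *)
Definition dunkl_weight x k : R := x ^+ k / gamma_dunkl mu k / exp_dunkl mu x.

Section FixedArgument.
Variable x : R.
Hypothesis x0 : 0 <= x.
Local Notation P := (dunkl_weight x).

Lemma dunkl_weight_ge0 k : 0 <= P k.
Proof.
by rewrite divr_ge0 ?divr_ge0 ?exprn_ge0// ltW// ?gamma_dunkl_gt0// exp_dunkl_gt0.
Qed.

Lemma cvg_series_dunkl_weight : series P @ \oo --> (1 : R).
Proof.
have e0 : exp_dunkl mu x != 0 by rewrite gt_eqF// exp_dunkl_gt0.
rewrite -(divff e0).
have -> : series P = (fun n => pseries (fun k => (gamma_dunkl mu k)^-1) x n / exp_dunkl mu x).
  apply/funext => n; rewrite /pseries /series/= mulr_suml.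
  by apply: eq_bigr => k _; rewrite /dunkl_weight (mulrC (x ^+ k)).
by apply: cvgMl; exact: cvg_exp_dunkl.
Qed.

(** The identity that replaces [k P_k = x P_(k-1)] for the Poisson law; all
    moments below come from it. *)
Lemma dunkl_weightS k : P k.+1 * dunkl_nat k.+1 = x * P k.
Proof.
rewrite /dunkl_weight gamma_dunkl_rec exprS.
have h0 : dunkl_nat k.+1 != 0.
  by rewrite gt_eqF//; apply: lt_le_trans (dunkl_nat_ge _); rewrite ltr0n.
field; rewrite h0 gt_eqF ?exp_dunkl_gt0//= gt_eqF//; exact: gamma_dunkl_gt0.
Qed.

Lemma dunkl_nat0 : dunkl_nat 0 = 0.
Proof. by rewrite /dunkl_nat /theta/= mulr0 addr0. Qed.

(** The first moment of a truncated sum is exact up to the shift by one index;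
    [sum_dunkl_variance_le] relies on the equality and not just on the bound. *)
Lemma sum_dunkl_weight1 n :
  \sum_(0 <= k < n.+1) P k * dunkl_nat k = x * series P n.
Proof.
rewrite big_nat_recl// dunkl_nat0 mulr0 add0r /series/= mulr_sumr.
by apply: eq_bigr => k _; exact: dunkl_weightS.
Qed.

Lemma series_dunkl_weight_le1 n : series P n <= 1.
Proof. exact: ge0_series_le_lim dunkl_weight_ge0 cvg_series_dunkl_weight. Qed.

Lemma sum_dunkl_weight1_le n : \sum_(0 <= k < n) P k * dunkl_nat k <= x.
Proof.
case: n => [|n]; first by rewrite big_nil.
by rewrite sum_dunkl_weight1 ler_piMr// series_dunkl_weight_le1.
Qed.

Lemma sum_dunkl_weight2_le n :
  \sum_(0 <= k < n.+1) P k * dunkl_nat k ^+ 2 <= (x ^+ 2 + (1 + 2 * mu) * x) * series P n.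
Proof.
rewrite big_nat_recl// dunkl_nat0 expr0n mulr0 add0r.
apply: (@le_trans _ _ (x * \sum_(0 <= k < n) P k * (dunkl_nat k + (1 + 2 * mu)))).
  rewrite mulr_sumr; apply: ler_sum => k _.
  rewrite expr2 mulrA dunkl_weightS -mulrA ler_wpM2l// ler_wpM2l ?dunkl_weight_ge0//.
  exact: dunkl_natS.
(* The factor [series P n] is kept instead of its bound 1: it has to cancel
   against the first moment in the variance estimate. *)
have S1 : \sum_(0 <= k < n) P k * dunkl_nat k <= x * series P n.
  case: n => [|n]; first by rewrite /series/= !big_nil mulr0.
  rewrite sum_dunkl_weight1 ler_wpM2l//.
  exact: (ge0_sum_nat_widen P _ _ dunkl_weight_ge0 (leqnSn n)).
have -> : \sum_(0 <= k < n) P k * (dunkl_nat k + (1 + 2 * mu)) =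
    \sum_(0 <= k < n) P k * dunkl_nat k + (1 + 2 * mu) * series P n.
  rewrite /series/= mulr_sumr -big_split/=.
  by apply: eq_bigr => k _; ring.
rewrite [leRHS](_ : _ = x * (x * series P n + (1 + 2 * mu) * series P n)); last by ring.
by rewrite ler_wpM2l// lerD2r.
Qed.

(** Expanding the square leaves the error [x^2 P_m] on the truncated sums, since
    the terms in [x^2] only cancel in the limit.  As the truncated sums increase
    and [P_m] tends to 0, the error disappears from the bound. *)
Lemma sum_dunkl_variance_le n :
  \sum_(0 <= k < n) P k * (dunkl_nat k - x) ^+ 2 <= (1 + 2 * mu) * x.
Proof.
have T m : \sum_(0 <= k < m.+1) P k * (dunkl_nat k - x) ^+ 2 <=
    x ^+ 2 * P m + (1 + 2 * mu) * x.
  have -> : \sum_(0 <= k < m.+1) P k * (dunkl_nat k - x) ^+ 2 =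
      \sum_(0 <= k < m.+1) P k * dunkl_nat k ^+ 2
      - 2 * x * (\sum_(0 <= k < m.+1) P k * dunkl_nat k) + x ^+ 2 * series P m.+1.
    rewrite /series/= !mulr_sumr -sumrN -!big_split/=.
    by apply: eq_bigr => k _; ring.
  have := sum_dunkl_weight2_le m.
  rewrite sum_dunkl_weight1.
  have -> : series P m.+1 = series P m + P m by rewrite /series/= big_nat_recr.
  have : (1 + 2 * mu) * x * series P m <= (1 + 2 * mu) * x.
    rewrite ler_piMr ?series_dunkl_weight_le1// mulr_ge0//.
    by have := mu0; lra.
  set S := series P m; set A := \sum_(_ <= _ < _) _.
  lra.
have P0 : P @ \oo --> (0 : R).
  by apply: cvg_series_cvg_0; apply/cvg_ex; exists 1; exact: cvg_series_dunkl_weight.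
have L : x ^+ 2 * P m + (1 + 2 * mu) * x @[m --> \oo] --> (1 + 2 * mu) * x.
  rewrite -[X in _ --> X]add0r -[X in _ --> X + _](mulr0 (x ^+ 2)).
  by apply: cvgD; [exact: cvgMr|exact: cvg_cst].
rewrite -(cvg_lim _ L)//; apply: limr_ge; first by apply/cvg_ex; eexists; exact: L.
near=> m; apply: le_trans (T m).
apply: (ge0_sum_nat_widen (fun k => P k * (dunkl_nat k - x) ^+ 2)).
  by move=> k; rewrite mulr_ge0 ?dunkl_weight_ge0// sqr_ge0.
by apply: leqW; near: m; exact: nbhs_infty_ge.
Unshelve. all: by end_near. Qed.

End FixedArgument.
End DunklWeights.

(** * The law attached to the Appell coefficients *)

Section AppellWeights.
Context {R : realType}.
Variables (mu : R) (a : nat -> R) (rho : R).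
Hypothesis mu0 : 0 <= mu.
Hypothesis rho1 : 1 < rho.
Hypothesis an : analytic_disc (appell_coef mu a) rho.
Hypothesis A1 : appell_gen mu a 1 != 0.
Hypothesis apos : forall r : nat, 0 <= a r / appell_gen mu a 1.

Definition appell_weight r : R := appell_coef mu a r / appell_gen mu a 1.
Local Notation b := appell_weight.

Lemma appell_weight_ge0 r : 0 <= b r.
Proof.
rewrite /appell_weight /appell_coef mulrAC mulr_ge0// invr_ge0 ltW//.
exact: gamma_dunkl_gt0.
Qed.

Lemma cvg_series_appell_weight : series b @ \oo --> (1 : R).
Proof.
rewrite -(divff A1).
have -> : series b = (fun n => pseries (appell_coef mu a) 1 n / appell_gen mu a 1).
  apply/funext => n; rewrite /pseries /series/= mulr_suml.
  by apply: eq_bigr => k _; rewrite expr1n mulr1.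
have : cvgn (pseries (appell_coef mu a) 1) by apply: an; rewrite normr1.
by move=> h; apply: cvgMl.
Qed.

(** Bernoulli's inequality gives [r + c <= C (1 + d)^r], so the second moment is
    at most [C^2] times the power series at [(1 + d)^2], a point that is inside
    the disc for small [d]. *)
Lemma appell_weight_moment2 c : 0 <= c ->
  exists B, forall n, \sum_(0 <= r < n) b r * (r%:R + c) ^+ 2 <= B.
Proof.
move=> c0; have r1 := rho1.
(* For [d <= 1], [(1 + d)^2 <= 1 + 3 d], which is below [rho] by the choice of
   [d]. *)
pose d : R := Num.min 1 ((rho - 1) / 4).
have d0 : 0 < d by rewrite lt_min; apply/andP; split; lra.
have d1 : d <= 1 by rewrite ge_min lexx.
have d2 : d <= (rho - 1) / 4 by rewrite ge_min lexx orbT.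
pose t : R := (1 + d) ^+ 2.
have tr : t < rho.
  apply: (@le_lt_trans _ _ (1 + 3 * d)); last lra.
  rewrite /t (_ : (1 + d) ^+ 2 = 1 + 2 * d + d * d); last by ring.
  have : d * d <= d by rewrite ler_piMr// ltW.
  lra.
have t0 : 0 <= t by exact: sqr_ge0.
have cv : cvgn (series (fun r => b r * t ^+ r)).
  have -> : series (fun r => b r * t ^+ r) =
      (fun n => pseries (appell_coef mu a) t n / appell_gen mu a 1).
    apply/funext => n; rewrite /pseries /series/= mulr_suml.
    by apply: eq_bigr => k _; rewrite /appell_weight mulrAC.
  apply: is_cvgMl; apply: an; rewrite ger0_norm//.
pose C := d^-1 + c.
have C0 : 0 <= C by rewrite addr_ge0// invr_ge0 ltW.
have bern r : r%:R + c <= C * (1 + d) ^+ r.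
  have h : 1 + r%:R * d <= (1 + d) ^+ r.
    elim: r => [|r IH]; first by rewrite mul0r addr0 expr0.
    rewrite exprS; apply: (@le_trans _ _ ((1 + d) * (1 + r%:R * d))).
      rewrite -natr1 (_ : (1 + d) * (1 + r%:R * d) = 1 + (r%:R + 1) * d + r%:R * d ^+ 2).
        by rewrite lerDl mulr_ge0// sqr_ge0.
      by ring.
    by rewrite ler_wpM2l//; lra.
  apply: (@le_trans _ _ (C * (1 + r%:R * d))); last by rewrite ler_wpM2l.
  rewrite /C (_ : (d^-1 + c) * (1 + r%:R * d) = r%:R + c + (d^-1 + c * (r%:R * d))).
    by rewrite lerDl addr_ge0 ?invr_ge0 ?(ltW d0)// !mulr_ge0// ltW.
  by field; rewrite gt_eqF.
exists (C ^+ 2 * limn (series (fun r => b r * t ^+ r))) => n.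
apply: (@le_trans _ _ (C ^+ 2 * series (fun r => b r * t ^+ r) n)).
  rewrite /series/= mulr_sumr; apply: ler_sum => r _.
  rewrite [leRHS]mulrCA ler_wpM2l ?appell_weight_ge0//.
  have -> : C ^+ 2 * t ^+ r = (C * (1 + d) ^+ r) ^+ 2.
    by rewrite [in RHS]exprMn -[in RHS]exprM mulnC exprM.
  by rewrite lerXn2r// nnegrE ?addr_ge0// mulr_ge0// exprn_ge0//; lra.
rewrite ler_wpM2l ?sqr_ge0//; apply: ge0_series_le_lim => // r.
by rewrite mulr_ge0 ?appell_weight_ge0// exprn_ge0.
Qed.

End AppellWeights.

(** * Quadratic majorants of the oscillation of a function *)

Section Modulus.
Context {R : realType}.
Implicit Types f : R -> R.

(** Convergence of the quotient gives the bound near infinity, and the extreme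
    value theorem gives it on the remaining segment. *)
Lemma in_E_growth f : {within `[0, +oo[, continuous f} -> in_E f ->
  exists2 M, 0 <= M & forall t, 0 <= t -> `|f t| <= M * (1 + t ^+ 2).
Proof.
move=> cf [l fl].
have [T [_ HT]] : \forall x \near +oo, `|l - f x / (1 + x ^+ 2)| < 1.
  by move/cvgrPdist_lt : fl; apply.
pose T' := Num.max T 0.
have [||m _ Hm] := @EVT_max R (fun x => `|f x|) 0 T'.
- by rewrite le_max lexx orbT.
- move=> x; apply: continuous_comp; last exact: norm_continuous.
  suff: {within `[0, T'], continuous f} by exact.
  by apply: continuous_subspaceW cf; apply: subset_itvl.
exists (`|f m| + (`|l| + 1)) => [|t t0]; first by rewrite !addr_ge0.
have p0 : 1 <= 1 + t ^+ 2 by rewrite lerDl sqr_ge0.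
have [tT|tT] := leP t T'.
  apply: (@le_trans _ _ `|f m|); first by apply: Hm; rewrite in_itv/= t0 tT.
  apply: (@le_trans _ _ (`|f m| + (`|l| + 1))); first by rewrite lerDl addr_ge0.
  by rewrite ler_peMr// !addr_ge0.
have tT2 : T < t by apply: le_lt_trans tT; rewrite le_max lexx.
have := HT _ tT2 => H.
have : `|f t / (1 + t ^+ 2)| <= `|l| + 1.
  rewrite -[X in `|X|](subKr l); apply: (le_trans (ler_normB _ _)).
  by rewrite lerD2l ltW.
rewrite normrM normfV [X in _ / X]ger0_norm; last lra.
rewrite ler_pdivrMr; last lra.
move=> h; apply: (le_trans h); rewrite ler_wpM2r//; first lra.
by rewrite lerDr.
Qed.

(** Near [t = x] continuity gives the bound [e]; away from [x] the quadratic growth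
    of [f] is absorbed by [C (t - x)^2] for [C] large.  Both hold locally
    uniformly in [x], and compactness provides a single [C] for all of [K]. *)
Lemma quadratic_modulus f (K : set R) e : compact K -> K `<=` `[0, +oo[ ->
  {within `[0, +oo[, continuous f} -> in_E f -> 0 < e ->
  exists2 C, 0 <= C &
    forall x t, K x -> 0 <= t -> `|f t - f x| <= e + C * (t - x) ^+ 2.
Proof.
move=> cK K0 cf Ef e0.
have [M M0 fM] := in_E_growth f cf Ef.
move/compact_near_coveringP/near_covering_withinP : cK => cK.
pose P C x := forall t, 0 <= t -> `|f t - f x| <= e + C * (t - x) ^+ 2.
have : \forall C \near +oo, K `<=` P C.
  apply: cK => x Kx.
  have x0 : 0 <= x by have := K0 x Kx; rewrite /= in_itv/= andbT.
  have [d /= d0 Hd] : exists2 d, 0 < d & forall t, 0 <= t -> `|t - x| < d -> `|f t - f x| < e / 2.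
    move/subspace_continuousP : cf => /(_ x); rewrite /= in_itv/= andbT => /(_ x0).
    move=> /cvgrPdist_lt /(_ (e / 2)); rewrite divr_gt0// => /(_ isT).
    rewrite near_withinE => /nbhs_ballP[d /= d0 Hd].
    exists d => // t t0 tx; rewrite distrC; apply: Hd; last by rewrite in_itv/= t0.
    by rewrite /ball/= distrC.
  pose d' := Num.min d 1.
  have d'0 : 0 < d' by rewrite lt_min d0 ltr01.
  have d'd : d' <= d by rewrite ge_min lexx.
  have d'1 : d' <= 1 by rewrite ge_min lexx orbT.
  (* If [|t - x| >= d'] then [|t - y| >= d' / 2], so the constants of the growth
     bound are at most themselves times [4 (t - y)^2 / d'^2]; the final [2] comes
     from [t^2 <= 2 (t - y)^2 + 2 y^2]. *)
  pose C0 := M * ((2 + 3 * (x + 1) ^+ 2) * 4 / d' ^+ 2 + 2).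
  near=> y C => Ky t t0.
  have y0 : 0 <= y by have := K0 y Ky; rewrite /= in_itv/= andbT.
  have yx : `|y - x| < d' / 2.
    by rewrite distrC; near: y; apply: nbhsx_ballx; rewrite divr_gt0.
  have CC0 : C0 <= C by near: C; apply: nbhs_pinfty_ge; rewrite num_real.
  have C00 : 0 <= C0.
    rewrite mulr_ge0// addr_ge0// divr_ge0 ?sqr_ge0// mulr_ge0// addr_ge0//.
    by rewrite mulr_ge0// sqr_ge0.
  have [tx|tx] := ltP `|t - x| d'.
    have h1 := Hd t t0 (lt_le_trans tx d'd).
    have h2 : `|f y - f x| < e / 2.
      apply: Hd => //; apply: (lt_le_trans yx); lra.
    apply: (@le_trans _ _ e); last by rewrite lerDl mulr_ge0 ?sqr_ge0// (le_trans C00).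
    rewrite (_ : f t - f y = (f t - f x) - (f y - f x)); last by ring.
    apply: (le_trans (ler_normB _ _)); lra.
  have ty : d' / 2 <= `|t - y|.
    have : `|t - x| <= `|t - y| + `|y - x| by rewrite -[t - x](subrKA y); exact: ler_normD.
    lra.
  have ty2 : d' ^+ 2 / 4 <= (t - y) ^+ 2.
    rewrite -[leRHS]real_normK ?num_real// (_ : d' ^+ 2 / 4 = (d' / 2) ^+ 2); last by field.
    by rewrite lerXn2r// nnegrE; lra.
  have yx1 : y <= x + 1 by move: yx; rewrite ltr_norml => /andP[_]; lra.
  apply: (@le_trans _ _ (C0 * (t - y) ^+ 2)); last first.
    by apply: (@le_trans _ _ (C * (t - y) ^+ 2)); [rewrite ler_wpM2r ?sqr_ge0|rewrite lerDr ltW].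
  apply: (le_trans (ler_normB _ _)).
  apply: (le_trans (lerD (fM t t0) (fM y y0))).
  rewrite -mulrDr /C0 -mulrA ler_wpM2l//.
  have y2 : y ^+ 2 <= (x + 1) ^+ 2 by rewrite lerXn2r// nnegrE; lra.
  have t2 : t ^+ 2 <= 2 * (t - y) ^+ 2 + 2 * y ^+ 2.
    rewrite -subr_ge0 (_ : _ - _ = (t - 2 * y) ^+ 2); last by ring.
    exact: sqr_ge0.
  have Z : 1 <= 4 / d' ^+ 2 * (t - y) ^+ 2.
    apply: (@le_trans _ _ (4 / d' ^+ 2 * (d' ^+ 2 / 4))).
      by rewrite le_eqVlt; apply/orP; left; apply/eqP; field; rewrite gt_eqF.
    by rewrite ler_wpM2l// divr_ge0// sqr_ge0.
  rewrite mulrDl.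
  have : 2 + 3 * (x + 1) ^+ 2 <= (2 + 3 * (x + 1) ^+ 2) * 4 / d' ^+ 2 * (t - y) ^+ 2.
    rewrite -!(mulrA (2 + 3 * (x + 1) ^+ 2)) ler_peMr//.
    by have := sqr_ge0 (x + 1); lra.
  lra.
move=> [T [_ HT]].
exists (Num.max T 0 + 1) => [|x t Kx t0].
  by rewrite addr_ge0// le_max lexx orbT.
by apply: HT => //; rewrite ltr_pwDr// le_max lexx.
Unshelve. all: by end_near. Qed.
End Modulus.

(** * Convergence of the operators *)

Section Operator.
Context {R : realType}.
Variables (mu lam : R) (a : nat -> R) (rho : R).
Hypothesis mu0 : 0 <= mu.
Hypothesis lam0 : 0 <= lam.
Hypothesis rho1 : 1 < rho.
Hypothesis an : analytic_disc (appell_coef mu a) rho.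
Hypothesis A1 : appell_gen mu a 1 != 0.
Hypothesis apos : forall r : nat, 0 <= a r / appell_gen mu a 1.

(** Shape of the gamma law that is integrated in the k-th term of the operator. *)
Definition gamma_shape k : R := k%:R + 2 * mu * theta k + lam + 1.

Definition Dstar_weight x : nat -> R := cauchy_prod (dunkl_weight mu x) (appell_weight mu a).

Lemma appell_polyE k x : 0 <= x ->
  appell_poly mu a k x / gamma_dunkl mu k =
  exp_dunkl mu x * appell_gen mu a 1 * Dstar_weight x k.
Proof.
move=> x0; rewrite /Dstar_weight /cauchy_prod mulr_sumr /appell_poly mulr_suml.
apply: eq_bigr => m _; rewrite /dunkl_weight /appell_weight /appell_coef.
have g0 j : gamma_dunkl mu j != 0 by rewrite gt_eqF// gamma_dunkl_gt0.
have e0 : exp_dunkl mu x != 0 by rewrite gt_eqF// exp_dunkl_gt0.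
by field; rewrite A1 e0 !g0.
Qed.

Lemma gamma_mean_shape (c p : R) f :
  c `^ (p + 1) / Gamma (p + 1) *
    \int[lebesgue_measure]_(t in `[0%R:R, +oo[) (expR (- (c * t)) * t `^ p * f t) =
  gamma_mean c (p + 1) f.
Proof.
rewrite /gamma_mean; congr (_ * _); apply: eq_Rintegral => t _.
by rewrite /gamma_kernel addrK.
Qed.

(** With [u = n x] and [c = 2 mu + lam + 1], the second moment about [x] of the
    k-th gamma law, times [n^2], is [s + (s - u)^2] for its shape [s].  When
    [k = m + r] this splits as a function of [m], namely [h + 2 (h - u)^2] with
    [h = dunkl_nat mu m], plus a function of [r], namely [3 (r + c)^2].  The two
    are then summed separately, against the Dunkl and the Appell weights. *)
Lemma Dstar_close (n : nat) f (x y e C B : R) : (0 < n)%N -> 0 <= x ->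
  {within `[0%R:R, +oo[, continuous f} -> 0 <= e -> 0 <= C ->
  (forall t, 0 <= t -> `|f t - y| <= e + C * (t - x) ^+ 2) ->
  (forall N, \sum_(0 <= r < N) appell_weight mu a r * (r%:R + (2 * mu + lam + 1)) ^+ 2 <= B) ->
  `|Dstar mu lam a n f x - y| <=
    e + C * (((3 + 4 * mu) * (n%:R * x) + 3 * B) / n%:R ^+ 2).
Proof.
have m0 := mu0; have l0 := lam0.
move=> n0 x0 cf e0 C0 fC HB.
have nR : 0 < n%:R :> R by rewrite ltr0n.
pose u : R := n%:R * x; have u0 : 0 <= u by rewrite mulr_ge0.
pose c := 2 * mu + lam + 1.
pose V k := gamma_shape k / n%:R ^+ 2 + (gamma_shape k / n%:R - x) ^+ 2.
pose al m := (dunkl_nat mu m + 2 * (dunkl_nat mu m - u) ^+ 2) / n%:R ^+ 2.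
pose be (r : nat) : R := 3 * (r%:R + c) ^+ 2 / n%:R ^+ 2.
have P0 := dunkl_weight_ge0 mu mu0 u u0.
have b0 := appell_weight_ge0 mu a mu0 apos.
have P1 := cvg_series_dunkl_weight mu mu0 u u0.
have b1 := cvg_series_appell_weight mu a rho rho1 an A1.
have h0 := dunkl_nat_ge0 mu mu0.
have n2 : 0 < n%:R ^+ 2 :> R by rewrite exprn_gt0.
have w0 k : 0 <= Dstar_weight u k by exact: cauchy_prod_ge0.
have w1 : series (Dstar_weight u) @ \oo --> (1 : R).
  by rewrite -[X in _ --> X](mulr1 1); exact: cvg_series_cauchy_prod.
have shape1 k : 1 <= gamma_shape k.
  by have := h0 k; rewrite /gamma_shape /dunkl_nat; lra.
have HI k : `|gamma_mean n%:R (gamma_shape k) f - y| <= e + C * V k.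
  exact: gamma_mean_close.
have HV N : \sum_(0 <= k < N) Dstar_weight u k * V k <=
    ((3 + 4 * mu) * u + 3 * B) / n%:R ^+ 2.
  rewrite mulrDl; apply: (cauchy_prod_weighted_le _ _ V al be) => //.
  - by move=> m; rewrite divr_ge0 ?(ltW n2)// addr_ge0// mulr_ge0// sqr_ge0.
  - by move=> r; rewrite divr_ge0 ?(ltW n2)// mulr_ge0// sqr_ge0.
  - move=> m r.
    have -> : V (m + r)%N = (gamma_shape (m + r) + (gamma_shape (m + r) - u) ^+ 2) / n%:R ^+ 2.
      by rewrite /V /u; field; rewrite gt_eqF.
    rewrite /al /be -mulrDl ler_wpM2r ?invr_ge0 ?(ltW n2)//.
    have : `|gamma_shape (m + r) - dunkl_nat mu m| <= r%:R + c.
      rewrite /gamma_shape -/(dunkl_nat mu (m + r)).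
      have := dunkl_nat_shift mu mu0 m r; rewrite !ler_norml => /andP[? ?].
      by apply/andP; split; rewrite /c; lra.
    set s := gamma_shape _; set h := dunkl_nat mu m => sh.
    have r0 : 0 <= r%:R :> R by [].
    have d2 : (s - h) ^+ 2 <= (r%:R + c) ^+ 2.
      rewrite -[leLHS]real_normK ?num_real//.
      by rewrite lerXn2r// ?nnegrE// /c; lra.
    have su : (s - u) ^+ 2 <= 2 * (h - u) ^+ 2 + 2 * (s - h) ^+ 2.
      rewrite -subr_ge0 (_ : _ - _ = ((h - u) - (s - h)) ^+ 2); last by ring.
      exact: sqr_ge0.
    have sh' : s <= h + (r%:R + c) by move: sh; rewrite ler_norml => /andP[_]; lra.
    (* This is where [c >= 1] matters: it turns [r + c] into the third square in
       [be]. *)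
    have c1 : r%:R + c <= (r%:R + c) ^+ 2.
      by rewrite expr2 ler_peMr// /c; lra.
    lra.
  - move=> M.
    have -> : \sum_(0 <= m < M) dunkl_weight mu u m * al m =
      (\sum_(0 <= m < M) dunkl_weight mu u m * dunkl_nat mu m +
       2 * \sum_(0 <= m < M) dunkl_weight mu u m * (dunkl_nat mu m - u) ^+ 2) / n%:R ^+ 2.
      rewrite mulr_sumr -big_split/= mulr_suml; apply: eq_bigr => m _.
      by rewrite /al mulrA; congr (_ / _); ring.
    rewrite ler_wpM2r ?invr_ge0 ?(ltW n2)//.
    have := sum_dunkl_weight1_le mu mu0 u u0 M.
    have := sum_dunkl_variance_le mu mu0 u u0 M.
    lra.
  - move=> M.
    have -> : \sum_(0 <= r < M) appell_weight mu a r * be r =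
      3 * (\sum_(0 <= r < M) appell_weight mu a r * (r%:R + c) ^+ 2) / n%:R ^+ 2.
      rewrite mulr_sumr mulr_suml; apply: eq_bigr => m _.
      by rewrite /be mulrA; congr (_ / _); ring.
    by rewrite ler_wpM2r ?invr_ge0 ?(ltW n2)// ler_wpM2l//; exact: HB.
have [l Hl ly] := cvg_series_weighted_mean _ _ _ _ _ _ _ w0 w1 e0 C0 HI HV.
suff -> : Dstar mu lam a n f x = l by exact: ly.
rewrite /Dstar -/u.
set E := exp_dunkl mu u * appell_gen mu a 1.
have E0 : E != 0 by rewrite mulf_neq0// gt_eqF// exp_dunkl_gt0.
rewrite [X in limn X](_ : _ = (fun N => E *
    series (fun k => Dstar_weight u k * gamma_mean n%:R (gamma_shape k) f) N)); last first.
  apply/funext => N; rewrite /series/= mulr_sumr; apply: eq_bigr => k _.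
  rewrite -mulrA gamma_mean_shape appell_polyE//.
  by rewrite -/E mulrA.
have EL : E * series (fun k => Dstar_weight u k * gamma_mean n%:R (gamma_shape k) f) N
    @[N --> \oo] --> E * l by exact: cvgMr.
by rewrite (cvg_lim _ EL)// mulrA div1r mulVf// mul1r.
Qed.

End Operator.

Theorem theorem1 (R : realType) (mu lam : R) (hmu : 0 <= mu) (hlam : 0 <= lam)
    (a : nat -> R) (ha0 : a 0%N != 0)
    (rho : R) (hrho : 1 < rho) (hA : analytic_disc (appell_coef mu a) rho)
    (hA1 : appell_gen mu a 1 != 0)
    (hpos : forall r : nat, 0 <= a r / appell_gen mu a 1)
    (f : R -> R) (hf : {within `[0, +oo[, continuous f}) (hE : in_E f)
    (K : set R) (hK : compact K) (hK0 : K `<=` `[0, +oo[) :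
  {uniform K, (fun n : nat => Dstar mu lam a n f) @ \oo --> f}.
Proof.
have [B HB] := appell_weight_moment2 mu a rho hmu hrho hA hpos (2 * mu + lam + 1) ltac:(lra).
have [X KX] : exists X, forall x, K x -> x <= X.
  have [M [_ HM]] := compact_bounded hK.
  exists (M + 1) => x /(HM (M + 1) _); rewrite ltrDl ltr01 => /(_ isT).
  exact: le_trans (ler_norm _).
have B0 : 0 <= B by have := HB 0%N; rewrite big_nil.
move=> Q /uniform_nbhs[E []]; rewrite -entourage_ballE => -[e /= e0 eE] EQ.
have [C C0 HC] := quadratic_modulus f K (e / 2) hK hK0 hf hE ltac:(lra).
pose D := (3 + 4 * mu) * `|X| + 3 * B.
have e20 : 0 <= e / 2 by lra.
have D0 : 0 <= D by rewrite addr_ge0// mulr_ge0//; lra.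
have : \forall n \near \oo, Q (Dstar mu lam a n f).
  near=> n; apply: EQ => x Kx; apply: eE; rewrite /ball/= distrC.
  have n0 : (0 < n)%N by near: n; exact: nbhs_infty_gt.
  have nR : 0 < n%:R :> R by rewrite ltr0n.
  have x0 : 0 <= x by have := hK0 x Kx; rewrite /= in_itv/= andbT.
  have nD : C * D / (e / 2) < n%:R.
    by near: n; exact: nbhs_infty_gtr.
  apply: (le_lt_trans (Dstar_close mu lam a rho hmu hlam hrho hA hA1 hpos n f x (f x)
    (e / 2) C B n0 x0 hf e20 C0 (fun t t0 => HC x t Kx t0) HB)).
  have W : ((3 + 4 * mu) * (n%:R * x) + 3 * B) / n%:R ^+ 2 <= D / n%:R.
    rewrite ler_pdivrMr ?exprn_gt0//.
    rewrite [leRHS](_ : _ = D * n%:R); last by field; rewrite gt_eqF.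
    rewrite /D [leRHS]mulrDl.
    apply: lerD; last by rewrite ler_peMr ?mulr_ge0// ler1n.
    rewrite -mulrA ler_wpM2l//; first by lra.
    by rewrite mulrC ler_wpM2r//; apply: (le_trans (KX x Kx)); exact: ler_norm.
  have : C * (((3 + 4 * mu) * (n%:R * x) + 3 * B) / n%:R ^+ 2) <= C * (D / n%:R).
    by rewrite ler_wpM2l.
  have : C * (D / n%:R) < e / 2.
    rewrite mulrA ltr_pdivrMr// [ltRHS]mulrC.
    by rewrite -ltr_pdivrMr// divr_gt0.
  lra.
by [].
Unshelve. all: by end_near. Qed.
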